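(* For every natural number $k\ge 2$, the class of $(k-1)$-size-disk graphs is a proper subclass of the class of $k$-size-disk graphs.
   Context: Graphs are finite and simple and classes of graphs are closed under isomorphism. For a nonempty family $\mathcal{F}$ of subsets of $\mathbb{R}^2$, the intersection graph $\mathrm{Int}(\mathcal{F})$ has vertex set $\mathcal{F}$, and two distinct members $A,B\in\mathcal{F}$ are adjacent if and only if $A\cap B\neq\emptyset$. A graph is a $k$-size-disk graph if it is isomorphic to the intersection graph of a family of (closed) disks in the plane of at most $k$ different sizes, i.e. having at most $k$ different radii. *)

(* Defs.v *)
From mathcomp Require Import all_boot all_order all_algebra finmap.
From mathcomp Require Import all_classical reals.

Set Implicit Arguments.
Unset Strict Implicit.
Unset Printing Implicit Defensive.

Import Order.TTheory GRing.Theory Num.Theory.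

Local Open Scope classical_set_scope.
Local Open Scope card_scope.
Local Open Scope ring_scope.

Record sgraph := SGraph {
  vertex :> finType;
  adj : rel vertex;
  adj_sym : symmetric adj;
  adj_irrefl : irreflexive adj }.

Definition isomorphic (G H : sgraph) : Prop :=
  exists2 f : G -> H, bijective f & forall x y, adj (f x) (f y) = adj x y.

Section IntersectionGraph.
Variables (T : Type) (F : {fset (set T)}).

Definition int_adj : rel F :=
  fun A B => (A != B) && `[< val A `&` val B !=set0 >].

Lemma int_adj_sym : symmetric int_adj.
Proof. by move=> A B; rewrite /int_adj eq_sym setIC. Qed.

Lemma int_adj_irrefl : irreflexive int_adj.
Proof. by move=> A; rewrite /int_adj eqxx. Qed.

(* The vertices are the members of the family themselves, so a set cannot be
   used for two different vertices. *)
Definition Int : sgraph := SGraph int_adj_sym int_adj_irrefl.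

End IntersectionGraph.

Section DiskGraphs.
Variable R : realType.

(* Written out because the library's norm on R * R is the sup norm, so that
   its closed balls are squares. *)
Definition closed_disk (c : R * R) (r : R) : set (R * R) :=
  [set p | (p.1 - c.1) ^+ 2 + (p.2 - c.2) ^+ 2 <= r ^+ 2].

(* Radii are positive: a single point is not a disk. *)
Definition is_disk (A : set (R * R)) : Prop :=
  exists (c : R * R) (r : R), 0 < r /\ A = closed_disk c r.

Definition radii (F : {fset (set (R * R))}) : set R :=
  [set r | 0 < r /\ exists c, closed_disk c r \in F].

Definition size_disk_graph (k : nat) (G : sgraph) : Prop :=
  exists F : {fset (set (R * R))},
    [/\ F != fset0, forall A : set (R * R), A \in F -> is_disk A,
        radii F #<= `I_k & isomorphic G (Int F)].

End DiskGraphs.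

(* Main.v *)
Require Import Defs.
From mathcomp Require Import all_boot all_order all_algebra finmap.
From mathcomp Require Import all_classical reals.
From mathcomp Require Import ring lra.

(** Nine pairwise disjoint disks cannot all meet a disk [D] and all be at least
    as large as [D]: two of their centres lie in the same octant as seen from
    the centre of [D], hence at an angle of at most 45 degrees, and are too
    close to each other ([octant_close], [smaller_neighbour]).  So a vertex with
    nine independent neighbours has a strictly smaller one among them.  If each
    of these has nine independent neighbours in turn, and so on to depth [n]
    (the predicate [branching]), then following smaller and smaller neighbours
    yields [n + 1] different radii ([branching_radii]).

    Conversely, depth [n] is realised with the [n + 1] radii
    [27 ^ 0, ..., 27 ^ n].  The disks of radius [27 ^ i] are centred on a line
    at multiples of [3 * 27 ^ i], so that disks of equal radius are disjoint,
    and for [i > 0] each contains the centres of nine disks of radius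
    [27 ^ i.-1] ([grid_disk]).  Such a graph of depth [k - 1] separates the two classes.
    For [k > 2] it is not a tree, since a small disk also meets all the larger disks around
    its centre; this is harmless because [branching] only asks for
    non-adjacency among the neighbours chosen for one vertex. *)

Set Implicit Arguments.
Unset Strict Implicit.
Unset Printing Implicit Defensive.

Import Order.TTheory GRing.Theory Num.Theory.

Local Open Scope classical_set_scope.
Local Open Scope card_scope.
Local Open Scope ring_scope.

(** * Branching vertices *)

(** The nine chosen neighbours of a vertex may be adjacent to anything except
    one another; this is what allows nested disks as a realisation. *)
Fixpoint branching (G : sgraph) (n : nat) (v : G) : Prop :=
  if n is n'.+1 then
    exists f : 'I_9 -> G,
      [/\ injective f, forall i, adj v (f i), forall i j, ~~ adj (f i) (f j)
        & forall i, branching n' (f i)]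
  else True.

Lemma isomorphic_refl (G : sgraph) : isomorphic G G.
Proof. by exists id => //; exists id. Qed.

Lemma branching_isomorphic (G H : sgraph) (f : G -> H) n (v : G) :
  injective f -> (forall x y, adj (f x) (f y) = adj x y) ->
  branching n v -> branching n (f v).
Proof.
move=> f_inj f_adj; elim: n v => //= n IHn v [g [g_inj vg gg gB]].
exists (f \o g); split => [|i|i j|i] /=; first exact: inj_comp.
- by rewrite f_adj.
- by rewrite f_adj.
- exact: IHn.
Qed.

(** * Disks in the plane *)

Section Disks.
Variable R : realType.
Implicit Types (c d u v : R * R) (r s a b : R).

Definition sqdist c d : R := (d.1 - c.1) ^+ 2 + (d.2 - c.2) ^+ 2.

Lemma mem_closed_disk c r d : closed_disk c r d = (sqdist c d <= r ^+ 2) :> Prop.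
Proof. by []. Qed.

Lemma disk_center c r : closed_disk c r c.
Proof. by rewrite mem_closed_disk /sqdist !subrr expr0n addr0 sqr_ge0. Qed.

(** Dividing the segment between the centres in the ratio of the radii gives a
    common point. *)
Lemma disks_meet c d r s : 0 < r -> 0 < s -> sqdist c d <= (r + s) ^+ 2 ->
  closed_disk c r `&` closed_disk d s !=set0.
Proof.
move=> r0 s0 cd; have rs0 : r + s != 0 by rewrite gt_eqF ?addr_gt0.
pose t := r / (r + s).
exists (c.1 + t * (d.1 - c.1), c.2 + t * (d.2 - c.2)).
split; rewrite mem_closed_disk /sqdist /=.
- have -> : r ^+ 2 = t ^+ 2 * (r + s) ^+ 2 by rewrite /t; field.
  rewrite [leLHS](_ : _ = t ^+ 2 * sqdist c d); last by rewrite /sqdist; ring.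
  by rewrite ler_wpM2l ?sqr_ge0.
- have -> : s ^+ 2 = (1 - t) ^+ 2 * (r + s) ^+ 2 by rewrite /t; field.
  rewrite [leLHS](_ : _ = (1 - t) ^+ 2 * sqdist c d); last by rewrite /sqdist; ring.
  by rewrite ler_wpM2l ?sqr_ge0.
Qed.

Lemma sqdist_meet c d r s : 0 < r -> 0 < s ->
  closed_disk c r `&` closed_disk d s !=set0 -> sqdist c d <= (r + s) ^+ 2.
Proof.
move=> r0 s0 [[p q] []]; rewrite !mem_closed_disk /sqdist /=.
set x := p - c.1; set y := q - c.2; set x' := p - d.1; set y' := q - d.2 => h h'.
have -> : d.1 - c.1 = x - x' by rewrite /x /x'; ring.
have -> : d.2 - c.2 = y - y' by rewrite /y /y'; ring.
(* Cauchy-Schwarz, from the square of [s * (x, y) + r * (x', y')]. *)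
have dot : - (x * x' + y * y') <= r * s.
  rewrite -(ler_pM2l (mulr_gt0 r0 s0)).
  have := sqr_ge0 (s * x + r * x'); have := sqr_ge0 (s * y + r * y').
  have := ler_wpM2l (sqr_ge0 s) h; have := ler_wpM2l (sqr_ge0 r) h'.
  lra.
lra.
Qed.

(** The two ends of the horizontal diameter of one disk lie in the other. *)
Lemma disk_sub_radius c d r s : 0 < r -> 0 < s ->
  closed_disk c r `<=` closed_disk d s -> r <= s.
Proof.
move=> r0 s0 cd.
have endpoint e : e ^+ 2 = r ^+ 2 -> closed_disk c r (c.1 + e, c.2).
  by rewrite mem_closed_disk /sqdist /= subrr expr0n addr0 addrAC subrr add0r => ->.
have /cd := endpoint r erefl; have /cd := endpoint (- r) (sqrrN r).
rewrite !mem_closed_disk /sqdist /= => h1 h2.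
rewrite -ler_sqr ?nnegrE ?(ltW r0) ?(ltW s0) //.
have := sqr_ge0 (c.1 - d.1); have := sqr_ge0 (c.2 - d.2).
move: c.1 c.2 d.1 d.2 h1 h2 => c1 c2 d1 d2; lra.
Qed.

Lemma disk_radius_inj c d r s : 0 < r -> 0 < s ->
  closed_disk c r = closed_disk d s -> r = s.
Proof.
move=> r0 s0 cd; apply: le_anti.
by apply/andP; split; [apply: (@disk_sub_radius c d) | apply: (@disk_sub_radius d c)];
   rewrite // cd.
Qed.

(** * Nine disjoint disks around a disk *)

Definition octant c d : bool * bool * bool :=
  (0 <= d.1 - c.1, 0 <= d.2 - c.2, `|d.1 - c.1| <= `|d.2 - c.2|).

(** At an angle of at most 45 degrees, the side of the triangle opposite to [c]
    is not the longest one. *)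
Lemma octant_close c u v : octant c u = octant c v ->
  sqdist u v <= sqdist c u \/ sqdist u v <= sqdist c v.
Proof.
rewrite /octant /sqdist.
set x := u.1 - c.1; set y := u.2 - c.2; set x' := v.1 - c.1; set y' := v.2 - c.2.
have -> : v.1 - u.1 = x' - x by rewrite /x /x'; ring.
have -> : v.2 - u.2 = y' - y by rewrite /y /y'; ring.
have same_sign (a b : R) : (0 <= a) = (0 <= b) -> a * b = `|a| * `|b|.
  case: (lerP 0 a) => a0 /esym ab.
    by rewrite ger0_norm // ger0_norm.
  by rewrite ltr0_norm // ltr0_norm ?mulrNN // ltNge ab.
case=> /same_sign xx /same_sign yy oct.
have dotE : (x' - x) ^+ 2 + (y' - y) ^+ 2
    = `|x| ^+ 2 + `|y| ^+ 2 + `|x'| ^+ 2 + `|y'| ^+ 2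
      - 2 * (`|x| * `|x'| + `|y| * `|y'|).
  by rewrite -xx -yy !real_normK ?num_real //; ring.
rewrite dotE -(real_normK (num_real x)) -(real_normK (num_real y)).
rewrite -(real_normK (num_real x')) -(real_normK (num_real y')).
move: oct (normr_ge0 x) (normr_ge0 y) (normr_ge0 x') (normr_ge0 y').
move: `|x| `|y| `|x'| `|y'| => {xx yy dotE} {}x {}y {}x' {}y' oct x0 y0 x'0 y'0.
(* The vector with the smaller dominant coordinate is the one that is short
   compared with the inner product. *)
case: (lerP x y) oct => xy /esym xy'.
- by case: (lerP y y') => yy'; [right|left]; nra.
- move/negbT: xy'; rewrite -ltNge => xy'.
  by case: (lerP x x') => xx'; [right|left]; nra.
Qed.

(** With nine disks and eight octants, two centres [d i] and [d j] share an
    octant, so they are no further apart than [r + s i] or [r + s j]; if [r] is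
    at most both radii, this is at most [s i + s j] and the two disks meet. *)
Lemma smaller_neighbour c r (d : 'I_9 -> R * R) (s : 'I_9 -> R) :
  0 < r -> (forall i, 0 < s i) ->
  (forall i, closed_disk c r `&` closed_disk (d i) (s i) !=set0) ->
  (forall i j, i != j ->
    ~ (closed_disk (d i) (s i) `&` closed_disk (d j) (s j) !=set0)) ->
  exists i, s i < r.
Proof.
move=> r0 s0 meet disj; apply: contrapT => /forallNP large.
have {}large i : r <= s i by rewrite leNgt; apply/negP.
have : ~ injective (fun i => octant c (d i)).
  by move=> /leq_card; rewrite !card_prod !card_bool card_ord.
apply => i j oct; apply/eqP; apply: contraT => /disj; case; apply: disks_meet => //.
have bound k : (k == i) || (k == j) -> (r + s k) ^+ 2 <= (s i + s j) ^+ 2.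
  rewrite ler_sqr ?nnegrE ?addr_ge0 ?(ltW r0) ?(ltW (s0 _)) //.
  by case/orP => /eqP ->; rewrite ?lerD2r // addrC lerD2l.
have near k := sqdist_meet r0 (s0 k) (meet k).
case: (octant_close oct) => h; apply: (le_trans h).
- by apply: (le_trans (near i)); apply: bound; rewrite eqxx.
- by apply: (le_trans (near j)); apply: bound; rewrite eqxx orbT.
Qed.

(** * Branching vertices force many radii *)

Lemma Int_adj (F : {fset set (R * R)}) (A B : Int F) :
  adj A B <-> A != B /\ val A `&` val B !=set0.
Proof.
split=> [/andP[AB /asboolP]|[AB meet]] //.
by apply/andP; split => //; apply/asboolP.
Qed.

(** By [smaller_neighbour], some chosen neighbour of [v] has a smaller radius;
    it still branches to depth [n - 1], so the descent can be repeated. *)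
Lemma branching_radii (F : {fset set (R * R)}) n (v : Int F) c r :
  (forall A : set (R * R), A \in F -> is_disk A) ->
  branching n v -> 0 < r -> val v = closed_disk c r ->
  exists s : seq R,
    [/\ size s = n, path >%R r s & forall x, x \in r :: s -> radii F x].
Proof.
move=> disks; elim: n v c r => [|n IHn] v c r /= brv r0 vE.
all: have rF : radii F r by split=> //; exists c; rewrite -vE; apply: valP.
  by exists [::]; split => // x; rewrite inE => /eqP ->.
case: brv => f [f_inj vf ff fB].
have /choice[d /choice[s ds]] (i : 'I_9) :
    exists d s, 0 < s /\ val (f i) = closed_disk d s.
  by apply: disks; apply: valP.
have [i|i|i j ij|i sir] := @smaller_neighbour c r d s r0.
- by case: (ds i).
- by case: (ds i) => _ <-; rewrite -vE; have /Int_adj[] := vf i.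
- case: (ds i) => _ <-; case: (ds j) => _ <- meet.
  move/negP: (ff i j); apply; apply/Int_adj; split => //.
  by apply: contraNneq ij => /f_inj ->.
have [si0 fiE] := ds i.
have [t [tn tp tF]] := IHn _ _ _ (fB i) si0 fiE.
exists (s i :: t); split => /=; first by rewrite tn.
- by rewrite sir.
- by move=> x; rewrite inE => /orP[/eqP -> //|/tF].
Qed.

(** The decreasing chain of [branching_radii] consists of [k + 1] different
    radii. *)
Lemma branching_not_size_disk_graph (G : sgraph) (v : G) k :
  branching k v -> ~ size_disk_graph R k G.
Proof.
move=> brv [F [_ disks card_radii [f f_bij f_adj]]].
have [c [r [r0 fvE]]] := disks _ (valP (f v)).
have brfv := branching_isomorphic (bij_inj f_bij) f_adj brv.
have [s [sk sp sF]] := branching_radii disks brfv r0 fvE.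
have s_uniq : uniq (r :: s).
  by apply: (@sorted_uniq _ >%R) => //; [exact: rev_trans lt_trans | exact: ltxx].
suff : `I_k.+1 #<= `I_k by rewrite card_le_II ltnn.
apply: card_le_trans card_radii.
have rs_card : (nth 0 (r :: s)) @` `I_k.+1 #= `I_k.+1.
  apply: inj_card_eq => i j; rewrite !inE /= => ik jk /eqP.
  by rewrite nth_uniq /= ?sk //; move/eqP.
rewrite -(card_le_eql rs_card).
apply: subset_card_le => _ [i /= ik <-].
by apply: sF; apply: mem_nth; rewrite /= sk.
Qed.

(** * A family of disks of large branching depth *)

(** The spacing of three radii keeps the disks of a row disjoint, and the ratio
    27 leaves room for nine centres on a radius of the next larger disk: their
    offsets are [3 * j] small radii with [j < 9]. *)
Definition grid_disk (n m : nat) : set (R * R) :=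
  closed_disk (3 * 27 ^+ n * m%:R, 0) (27 ^+ n).

(** The recursion follows the branching: [27 * m + j] with [j < 9] are the
    positions, in the next finer row, of nine centres inside [grid_disk n m]. *)
Fixpoint grid (n m : nat) : seq (set (R * R)) :=
  grid_disk n m ::
    if n is n'.+1 then flatten [seq grid n' (27 * m + j) | j <- iota 0 9] else [::].

Lemma gridS n m : grid n.+1 m =
  grid_disk n.+1 m :: flatten [seq grid n (27 * m + j) | j <- iota 0 9].
Proof. by []. Qed.

Lemma grid_radius_gt0 n : 0 < 27 ^+ n :> R.
Proof. exact: exprn_gt0. Qed.

Lemma grid_diskP n m A : A \in grid n m -> exists i m', (i <= n)%N /\ A = grid_disk i m'.
Proof.
elim: n m => [|n IHn] m; rewrite ?gridS in_cons => /predU1P[->|].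
- by exists 0, m.
- by [].
- by exists n.+1, m.
- move=> /flattenP[s /mapP[j _ ->]] /IHn[i [m' [ip AE]]].
  by exists i, m'; split => //; apply: leqW.
Qed.

Lemma mem_grid n m : grid_disk n m \in grid n m.
Proof. by case: n => [|n]; rewrite /= in_cons eqxx. Qed.

Lemma sub_grid n m j : (j < 9)%N -> {subset grid n (27 * m + j) <= grid n.+1 m}.
Proof.
move=> j9 A Aj; rewrite gridS in_cons; apply/orP; right.
apply/flattenP; exists (grid n (27 * m + j)) => //.
by apply/mapP; exists j; rewrite ?mem_iota.
Qed.

Lemma grid_disk_disjoint n m m' : m != m' ->
  ~ (grid_disk n m `&` grid_disk n m' !=set0).
Proof.
wlog: m m' / (m < m')%N => [hw mm' |mm' _].
  case: (ltngtP m m') mm' => // lt_mm' _; first by apply: hw; rewrite // neq_ltn lt_mm'.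
  by rewrite setIC; apply: hw; rewrite // neq_ltn lt_mm'.
have a0 := grid_radius_gt0 n.
move=> /(sqdist_meet a0 a0); rewrite /sqdist /= subrr expr0n addr0.
apply/negP; rewrite -ltNge.
have : m.+1%:R <= m'%:R :> R by rewrite ler_nat.
rewrite -natr1 => {}mm'.
move: (27 ^+ n) a0 => a a0.
have h : 3 * a <= 3 * a * m'%:R - 3 * a * m%:R.
  by rewrite -mulrBr ler_peMr; lra.
by rewrite ltr_sqr ?nnegrE; lra.
Qed.

Lemma grid_disk_center n m j : (j < 9)%N ->
  grid_disk n.+1 m (3 * 27 ^+ n * (27 * m + j)%:R, 0).
Proof.
move=> j9; rewrite /grid_disk mem_closed_disk /sqdist /= subrr expr0n addr0.
have a0 := grid_radius_gt0 n.
have j0 := ler0n R j; have {}j9 : j%:R <= 9 :> R by rewrite ler_nat ltnW.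
rewrite natrD natrM (exprS _ n); move: (27 ^+ n) a0 => a a0.
rewrite [X in X ^+ 2](_ : _ = 3 * a * j%:R); last by ring.
by rewrite ler_sqr ?nnegrE; nra.
Qed.

Lemma grid_branching (F : {fset set (R * R)}) n m (v : Int F) :
  {subset grid n m <= F} -> val v = grid_disk n m -> branching n v.
Proof.
elim: n m v => //= n IHn m v gF vE.
have sF (j : 'I_9) : {subset grid n (27 * m + j) <= F}.
  by move=> A /(sub_grid (ltn_ord j)) /gF.
pose f (j : 'I_9) : Int F := FSetSub (sF j _ (mem_grid n (27 * m + j))).
exists f; split => [i j /(congr1 val)/= fij|j|i j|j].
- apply/val_inj/eqP; rewrite -(eqn_add2l (27 * m)).
  apply: contraT => /(@grid_disk_disjoint n); rewrite fij setIid; case.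
  by eexists; apply: disk_center.
- apply/Int_adj; split.
    apply/eqP => vfj.
    have : grid_disk n.+1 m = grid_disk n (27 * m + j) by rewrite -vE vfj.
    move/(disk_radius_inj (grid_radius_gt0 _) (grid_radius_gt0 _)) => /eqP.
    by rewrite (exprS _ n); have := grid_radius_gt0 n; lra.
  suff : grid_disk n.+1 m `&` grid_disk n (27 * m + j) !=set0 by rewrite -vE.
  by eexists; split; [exact: grid_disk_center (ltn_ord j) | exact: disk_center].
- apply/negP => /Int_adj[ij] /=; apply: grid_disk_disjoint.
  by apply: contraNneq ij => ij; apply/eqP/val_inj => /=; rewrite ij.
- exact: IHn (sF j) _.
Qed.

Lemma grid_size_disk_graph n :
  size_disk_graph R n.+1 (Int [fset A in grid n 0]%fset).
Proof.
exists [fset A in grid n 0]%fset; split; last exact: isomorphic_refl.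
- by apply/fset0Pn; exists (grid_disk n 0); rewrite inE mem_grid.
- move=> A; rewrite inE => /grid_diskP[i [m [_ ->]]].
  by exists (3 * 27 ^+ i * m%:R, 0), (27 ^+ i); split; first exact: grid_radius_gt0.
apply: card_le_trans (card_image_le (fun i => 27 ^+ i : R) `I_n.+1).
apply: subset_card_le => r [r0 [c]]; rewrite inE => /grid_diskP[i [m [le_in]]].
move/(disk_radius_inj r0 (grid_radius_gt0 i)) => ->.
by exists i.
Qed.

Lemma size_disk_graph_le k l (G : sgraph) : (k <= l)%N ->
  size_disk_graph R k G -> size_disk_graph R l G.
Proof.
move=> kl [F [F0 disks card_radii GF]]; exists F; split => //.
by apply: card_le_trans card_radii _; rewrite card_le_II.
Qed.

End Disks.

Theorem theorem8 (R : realType) (k : nat) (hk : (2 <= k)%N) :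
  (forall G : sgraph, size_disk_graph R (k - 1)%N G -> size_disk_graph R k G) /\
  (exists G : sgraph, size_disk_graph R k G /\ ~ size_disk_graph R (k - 1)%N G).
Proof.
case: k hk => // k _; rewrite subn1 /=.
split=> [G|]; first exact: size_disk_graph_le.
pose G := Int [fset A in @grid R k 0]%fset.
exists G; split; first exact: grid_size_disk_graph.
have root_in : @grid_disk R k 0 \in [fset A in @grid R k 0]%fset by rewrite inE mem_grid.
have : @branching G k (FSetSub root_in).
  by apply: (@grid_branching _ _ k 0) => // A; rewrite inE.
exact: branching_not_size_disk_graph.
Qed.
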